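(* (Green's formulas) Let $(\Omega,\mu,d)$ be a metric measure space with $\mu(\Omega)<\infty$. Let $J\ge0$ be a kernel with $J\in L^\infty(\Omega,L^1(\Omega))\cap L^p(\Omega,L^{p'}(\Omega))$ for some $1\le p<\infty$ and $J(x,y)=J(y,x)$. Let $K_Ju(x)=\int_\Omega J(x,y)u(y)\,dy$ and $h_0(x)=\int_\Omega J(x,y)\,dy$. Then for $u\in L^p(\Omega)$ and $v\in L^{p'}(\Omega)$, $$\langle K_Ju-h_0u,\,v\rangle_{L^p,L^{p'}}=-\frac12\int_\Omega\int_\Omega J(x,y)\,(u(y)-u(x))\,(v(y)-v(x))\,dy\,dx.$$ In particular, if $p=2$, then for $u\in L^2(\Omega)$, $$\langle K_Ju-h_0u,\,u\rangle_{L^2,L^2}=-\frac12\int_\Omega\int_\Omega J(x,y)\,(u(y)-u(x))^2\,dy\,dx.$$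
   Context: A metric measure space $(\Omega,\mu,d)$ is a metric space $(\Omega,d)$ with a $\sigma$-finite, regular, complete Borel measure $\mu$ that associates a finite positive measure to the balls of $\Omega$. Integration is with respect to $\mu$. $p'$ is the conjugate exponent of $p$. $L^q(\Omega,Z)$ is the space of $Z$-valued $L^q$ functions, with $J$ identified with the map $x\mapsto J(x,\cdot)$. $\langle f,g\rangle_{L^p,L^{p'}}=\int_\Omega fg$. *)

(* Defs.v *)
From HB Require Import structures.
From mathcomp Require Import all_boot all_order all_algebra.
From mathcomp Require Import all_classical all_reals all_analysis.

Set Implicit Arguments.
Unset Strict Implicit.
Unset Printing Implicit Defensive.

Import Order.TTheory GRing.Theory Num.Theory.
Import numFieldNormedType.Exports.

Local Open Scope classical_set_scope.
Local Open Scope ring_scope.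

(* A set with both a metric and a sigma-algebra. The two are linked, through
   a measure, by [metric_measure_space] below. *)
#[short(type="metricMeasurableType")]
HB.structure Definition MetricMeasurable (d : measure_display) (R : realType) :=
  {T of Measurable d T & Metric R T}.

(* Regularity in the sense of Rudin: outer regularity with respect to open
   sets and inner regularity with respect to compact sets. *)
Definition regular_measure (d : measure_display) (R : realType)
    (T : metricMeasurableType d R) (mu : {measure set T -> \bar R}) : Prop :=
  forall A : set T, measurable A ->
    mu A = ereal_inf [set mu U | U in [set U | open U /\ A `<=` U]] /\
    mu A = ereal_sup [set mu K | K in [set K | compact K /\ K `<=` A]].

(* The sigma-algebra of [T] is only required to contain the Borel sets, since
   a complete Borel measure is in general defined on a larger one. *)
Record metric_measure_space (d : measure_display) (R : realType)
    (T : metricMeasurableType d R)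
    (mu : {sigma_finite_measure set T -> \bar R}) : Prop := {
  mms_borel : forall U : set T, open U -> measurable U ;
  mms_complete : measure_is_complete mu ;
  mms_regular : regular_measure mu ;
  mms_ball : forall (x : T) (r : R), 0 < r -> (0 < mu (ball x r) < +oo)%E
}.

Section Bochner.
Context {d : measure_display} {R : realType} {T : measurableType d}.
Variable mu : {measure set T -> \bar R}.
Implicit Types (q r : \bar R) (F : T -> T -> R).

(* Elements of L^r are represented by functions, so an L^r-valued function is
   represented by its curried form [F], with [F x] standing for the class of
   [F x] in L^r. *)
Definition bochner_simple r F : Prop :=
  exists (n : nat) (A : 'I_n -> set T) (z : 'I_n -> T -> R),
    [/\ forall i, measurable (A i),
        forall i, z i \in Lfun mu r
      & forall x y, F x y = \sum_(i < n) \1_(A i) x * z i y].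

Definition strongly_measurable r F : Prop :=
  exists s : nat -> T -> T -> R,
    (forall n, bochner_simple r (s n)) /\
    {ae mu, forall x,
      'N[mu]_r[EFin \o (F x \- s n x)%R]%E @[n --> \oo] --> 0%E}.

(* F belongs to L^q(T, L^r(T)). *)
Definition bochner_Lfun q r F : Prop :=
  [/\ {ae mu, forall x, F x \in Lfun mu r},
      strongly_measurable r F
    & ('N[mu]_q[(fun x => 'N[mu]_r[EFin \o F x])] < +oo)%E].

End Bochner.

Section Kernel.
Context {d : measure_display} {R : realType} {T : measurableType d}.
Variable mu : {sigma_finite_measure set T -> \bar R}.
Variable J : T -> T -> R.

(* [J] is measurable for the completion of [mu \x mu]: the sigma-algebra on
   [T * T] is the plain product, not complete even when [mu] is, so [J] need
   only agree almost everywhere with a function measurable for it. *)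
Definition kernel_measurable : Prop :=
  exists2 J' : T * T -> R, measurable_fun [set: T * T] J' &
    {ae (mu \x mu)%E, forall z, J z.1 z.2 = J' z}.

Definition kernel_ge0 : Prop := {ae (mu \x mu)%E, forall z, 0 <= J z.1 z.2}.

Definition kernel_sym : Prop :=
  {ae (mu \x mu)%E, forall z, J z.1 z.2 = J z.2 z.1}.

Definition K_op (u : T -> R) : T -> R := fun x => (\int[mu]_y (J x y * u y))%R.

Definition h0 : T -> R := fun x => (\int[mu]_y J x y)%R.

End Kernel.

(* Extended-valued, so that a divergent integral is not turned into 0. *)
Definition pairing {d : measure_display} {R : realType} {T : measurableType d}
    (mu : {measure set T -> \bar R}) (f g : T -> R) : \bar R :=
  (\int[mu]_x (f x * g x)%:E)%E.

(* Main.v *)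
Require Import Defs.
From HB Require Import structures.
From mathcomp Require Import all_boot all_order all_algebra.
From mathcomp Require Import all_classical all_reals all_analysis.
From mathcomp Require Import measurable_realfun ess_sup_inf.
From mathcomp Require Import ring lra.
Import Order.TTheory GRing.Theory Num.Theory.
Import numFieldNormedType.Exports.
Local Open Scope classical_set_scope.
Local Open Scope ring_scope.

(** Replacing [J] by a representative reduces the theorem to a kernel [k] that
is measurable for the product sigma-algebra, nonnegative and symmetric
everywhere, with [\int k (x, y) dy <= C] for almost every [x].  For such a
kernel, multiplying out
  [k (x, y) (u y - u x) (v y - v x)]
gives two diagonal terms, [k u(x) v(x)] and [k u(y) v(y)], and two cross
terms, [- k u(y) v(x)] and [- k u(x) v(y)].  The members of each pair are
exchanged by [(x, y) |-> (y, x)], so they have the same integral over the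
product, and the double integral is twice the diagonal integral minus the
cross integral.  By Fubini's theorem the pairing [<K u - h0 u, v>] is the cross
integral minus the diagonal one, whence the factor [- 1 / 2].

The analytic content is that all four terms are integrable.  The diagonal ones
are, since [h0] is bounded by [C] and [u v] is integrable by Hoelder's
inequality.  For the cross terms, Schur's test shows that [|u|] is mapped into
L^p by the operator of kernel [k] ([K_op_powR_le], [K_op_Lfun]), and Hoelder's
inequality against [v] concludes ([cross_integrable]).  The Schur bound
  [(\int k |u|) ^ p <= C ^ (p - 1) \int k |u| ^ p]
is Jensen's inequality for the sub-probability [k (x, y) / C dy]; it is proved
by integrating the tangent line inequality of the convex function [t ^ p]
([powR_tangent]).

Passing from [k] back to [J] takes place in [complete_green].  A property that
holds almost everywhere on the product holds on almost every section, so that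
for almost every [x] the integrals in [y] agree; completeness of the measure
makes the functions of [x] so obtained measurable, which is what comparing
their integrals requires. *)

(** * Null sets and integrals on a product *)

Section product_sections.
Context {d : measure_display} {R : realType} {T : measurableType d}.
Variable mu : {sigma_finite_measure set T -> \bar R}.
Local Open Scope ereal_scope.

Lemma ae_section (P : T * T -> Prop) :
  {ae (mu \x mu), forall z, P z} ->
  {ae mu, forall x, {ae mu, forall y, P (x, y)}}.
Proof.
move=> [N [mN N0 PN]].
have mx : measurable_fun [set: T] (fun x => mu (xsection N x)).
  exact: measurable_fun_xsection.
have : ae_eq mu [set: T] (fun x => mu (xsection N x)) (cst 0).
  apply/(ae_eq_integral_abs mu measurableT mx).
  by under eq_integral do rewrite gee0_abs//.
apply: filterS => x /= /(_ I) Nx0.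
exists (xsection N x); split => //; first exact: measurable_xsection.
by move=> y /= Pxy; rewrite /xsection/= inE; exact: PN.
Qed.

(** The image of a null set under the exchange of coordinates is null because
both iterated formulas for the product measure define the same measure. *)
Lemma ae_swap (P : T * T -> Prop) :
  {ae (mu \x mu), forall z, P z} ->
  {ae (mu \x mu), forall z, P (z.2, z.1)}.
Proof.
move=> [N [mN N0 PN]].
have mS : measurable (@swap_pair T T @^-1` N).
  by rewrite -[X in measurable X]setTI; exact: measurable_swap.
exists (@swap_pair T T @^-1` N); split => //; last first.
  by move=> z /= Pz; exact: PN.
transitivity ((mu \x^ mu) N).
  rewrite /product_measure1 /product_measure2.
  exact: eq_integral.
rewrite -N0; symmetry; apply: product_measure_unique => // A B mA mB /=.
by rewrite product_measure2E.
Qed.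

Lemma integrable_swap (f : T * T -> \bar R) :
  (mu \x mu).-integrable [set: T * T] f ->
  (mu \x mu).-integrable [set: T * T] (f \o swap_pair).
Proof.
move=> fi; have mf := measurable_int _ fi.
have mfs : measurable_fun [set: T * T] (f \o swap_pair).
  by apply: measurableT_comp => //; exact: measurable_swap.
by apply/integrable21ltyP => //; apply/integrable12ltyP.
Qed.

Lemma integral_swap (f : T * T -> \bar R) :
  (mu \x mu).-integrable [set: T * T] f ->
  \int[mu \x mu]_z (f \o swap_pair) z = \int[mu \x mu]_z f z.
Proof.
move=> fi; rewrite -integral21_prod_meas1; last exact: integrable_swap.
by rewrite -integral12_prod_meas1.
Qed.
End product_sections.

(** * Lebesgue spaces and Hoelder's inequality *)

Section Lp_complements.
Context {d : measure_display} {R : realType} {T : measurableType d}.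
Variable mu : {measure set T -> \bar R}.

(** The supremum norm is by convention 0 when the space is null; the bound is
then vacuously true almost everywhere. *)
Lemma Lnormy_bound (f : T -> \bar R) : ('N[mu]_+oo[f] < +oo)%E ->
  exists2 M : R, 0 <= M & {ae mu, forall x, (`|f x| <= M%:E)%E}.
Proof.
rewrite unlock /=; case: ifPn => [mu0 fy|]; last first.
  rewrite -leNgt => muT _; exists 0 => //.
  exists [set: T]; split => //; apply/eqP; rewrite eq_le muT/=.
  exact: measure_ge0.
have [M M0 fM] : exists2 M : R, 0 <= M & (ess_sup mu (abse \o f) <= M%:E)%E.
  move: fy; case: (ess_sup _ _) => [r _|//|_]; last by exists 0; rewrite ?leNye.
  by exists (Num.max 0 r); rewrite ?lee_fin le_max ?lexx ?orbT.
by exists M => //; move/ess_supP : fM.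
Qed.

Lemma LfunE (q : \bar R) (f : T -> R) : f \in Lfun mu q <->
  measurable_fun [set: T] f /\ ('N[mu]_q[EFin \o f] < +oo)%E.
Proof.
split; first by rewrite inE => /andP[/[!inE]/= mf].
by move=> [mf lf]; rewrite inE; apply/andP; split; rewrite inE.
Qed.

Lemma Lfun_powRP (p : R) (f : T -> R) : 1 <= p -> f \in Lfun mu p%:E <->
  measurable_fun [set: T] f /\ (\int[mu]_x (`|f x| `^ p)%:E < +oo)%E.
Proof.
move=> p1; split=> [pf|[mf fi]].
  split; first by have [] := (LfunE _ _).1 pf.
  have /integrableP[_] := Lfun_integrable p1 pf.
  by under eq_integral do rewrite gee0_abs ?lee_fin ?powR_ge0//.
by apply/LfunE; split => //; rewrite unlock; exact: poweR_lty.
Qed.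

Lemma measurable_norm_powR (p : R) (f : T -> R) :
  measurable_fun [set: T] f ->
  measurable_fun [set: T] (fun x => (`|f x| `^ p)%:E).
Proof.
move=> mf; apply/measurable_EFinP.
by apply: (measurableT_comp (measurable_powR _)) => //; exact: measurableT_comp.
Qed.

Lemma Lfun_dominated (p : R) (f g : T -> R) : 1 <= p ->
  measurable_fun [set: T] f -> g \in Lfun mu p%:E ->
  {ae mu, forall x, `|f x| <= `|g x|} -> f \in Lfun mu p%:E.
Proof.
move=> p1 mf lg fg; have [mg gi] := (Lfun_powRP p g p1).1 lg.
apply: (Lfun_powRP p f p1).2; split => //.
apply: le_lt_trans gi.
apply: ae_ge0_le_integral => //; [exact: measurable_norm_powR..|].
apply: filterS fg => x /= fg _; rewrite lee_fin.
by apply: ge0_ler_powR => //; rewrite ?nnegrE// (le_trans _ p1).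
Qed.

Lemma LfunB (p : R) (f g : T -> R) : 1 <= p ->
  f \in Lfun mu p%:E -> g \in Lfun mu p%:E ->
  (fun x => f x - g x) \in Lfun mu p%:E.
Proof.
move=> p1 lf lg; have p1' : (1 <= p%:E)%E by rewrite lee_fin.
apply: (Lfun_addr_closed mu p1').2 => //.
exact: Lfun_oppr_closed.
Qed.

(** Hoelder's inequality, including the exponents 1 and +oo: there, [g] is
essentially bounded and [f g] is dominated by a multiple of [f]. *)
Lemma Lfun_mul_integrable (p : R) (f g : T -> R) : 1 <= p ->
  f \in Lfun mu p%:E -> g \in Lfun mu (hoelder_conjugate p%:E) ->
  mu.-integrable [set: T] (fun x => (f x * g x)%:E).
Proof.
move=> p1 lf lg.
have [mf fy] := (LfunE _ _).1 lf.
have [mg gy] := (LfunE _ _).1 lg.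
apply/(Lfun1_integrable mu (fun x => f x * g x)).
have [pE1|pN1] := eqVneq p 1.
  move: gy lf; rewrite pE1 hoelder_conjugate1 => /Lnormy_bound[M M0 gM] lf.
  apply: (Lfun_dominated 1 _ (M \o* f)) => //.
  - exact: measurable_funM.
  - exact: Lfun_scale.
  apply: filterS gM => x; rewrite lee_fin => gM /=.
  by rewrite !normrM (ger0_norm M0) ler_wpM2l.
have pgt1 : 1 < p by rewrite lt_neqAle eq_sym pN1.
have p0 : 0 < p by rewrite (lt_trans _ pgt1).
have [q qE] : {q | hoelder_conjugate p%:E = q%:E}.
  exists (p / (p - 1)).
  by rewrite /hoelder_conjugate/= eqe gt_eqF// -EFinD inver subr_eq0 gt_eqF.
have q0 : 0 < q.
  rewrite (@lt_le_trans _ _ 1)// -lee_fin -qE.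
  by apply: hoelder_conj_ge1; rewrite lee_fin.
have pq : p^-1 + q^-1 = 1.
  have := @hoelder_conjugate_eq1 R p%:E (ltNyr p).
  rewrite qE eqe (gt_eqF p0) => /(_ isT).
  by rewrite !inver (gt_eqF p0) (gt_eqF q0) -EFinD => -[].
apply: (LfunE 1 (fun x => f x * g x)).2; split; first exact: measurable_funM.
apply: le_lt_trans (hoelder mu mf mg p0 q0 pq) _.
move: gy; rewrite qE => gy.
by apply: lte_mul_pinfty; rewrite ?ge0_fin_numE ?Lnorm_ge0.
Qed.

End Lp_complements.

(** * Schur's test for a symmetric kernel *)

(** The graph of the convex function [t `^ p] lies above its tangent line at
[s].  For [p > 1] this is Young's inequality applied to [t] and
[s `^ (p - 1)]. *)
Lemma powR_tangent (R : realType) (p s t : R) : 1 <= p -> 0 <= s -> 0 <= t ->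
  p * s `^ (p - 1) * t <= t `^ p + (p - 1) * s `^ p.
Proof.
move=> p1 s0 t0.
have [->|pN1] := eqVneq p 1.
  by rewrite subrr powRr0 powRr1// !mul1r mul0r addr0.
have pgt1 : 1 < p by rewrite lt_neqAle eq_sym pN1.
have p0 : 0 < p by rewrite (lt_trans _ pgt1).
have q0 : 0 < p - 1 by rewrite subr_gt0.
have := @conjugate_powR R t (s `^ (p - 1)) p (p / (p - 1)) t0 (powR_ge0 _ _) p0
  (divr_gt0 p0 q0).
have -> : p^-1 + (p / (p - 1))^-1 = 1.
  by field; rewrite gt_eqF//= gt_eqF.
move=> /(_ erefl); rewrite -powRrM.
have -> : (p - 1) * (p / (p - 1)) = p by field; rewrite gt_eqF.
move=> h.
have -> : t `^ p + (p - 1) * s `^ p = p * (t `^ p / p + s `^ p / (p / (p - 1))).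
  by field; rewrite !gt_eqF.
by rewrite -mulrA ler_pM2l// mulrC.
Qed.

Section symmetric_kernel.
Context {d : measure_display} {R : realType} {T : measurableType d}.
Variable mu : {sigma_finite_measure set T -> \bar R}.
Hypothesis muT : (mu [set: T] < +oo)%E.
Variables (k : T * T -> R) (C : R).
Hypothesis mk : measurable_fun [set: T * T] k.
Hypothesis k0 : forall z, 0 <= k z.
Hypothesis ksym : forall z, k (swap_pair z) = k z.
Hypothesis C0 : 0 < C.
Hypothesis kC : {ae mu, forall x, (\int[mu]_y (k (x, y))%:E <= C%:E)%E}.

Let mkx x : measurable_fun [set: T] (fun y => k (x, y)).
Proof. by apply: measurableT_comp => //; exact: measurable_pair1. Qed.

(** By Tonelli's theorem, integrating in [y] first costs a factor [C]. *)
Lemma kernel_mul1_integrable (g : T -> R) :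
  mu.-integrable [set: T] (EFin \o g) ->
  (mu \x mu)%E.-integrable [set: T * T] (fun z => (k z * g z.1)%:E).
Proof.
move=> ig; have /measurable_EFinP mg := measurable_int _ ig.
have mf : measurable_fun [set: T * T] (fun z => (k z * g z.1)%:E).
  apply/measurable_EFinP; apply: measurable_funM => //.
  by apply: measurableT_comp => //; exact: measurable_fst.
apply/integrable12ltyP => //.
have mF : measurable_fun [set: T] (fun x => \int[mu]_y `|(k (x, y) * g x)%:E|)%E.
  apply: (measurable_fun_fubini_tonelli_F (fun z => `|(k z * g z.1)%:E|)%E) => //.
  exact: measurableT_comp.
apply: (@le_lt_trans _ _ (\int[mu]_x (C%:E * `|(g x)%:E|))%E); last first.
  rewrite ge0_integralZl//.
  - by case/integrableP : ig => _ ig; rewrite lte_mul_pinfty// lee_fin ltW.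
  - by apply: measurableT_comp => //; exact/measurable_EFinP.
  - by rewrite lee_fin ltW.
apply: ae_ge0_le_integral => //.
- by move=> x _; exact: integral_ge0.
- by move=> x _; rewrite mule_ge0// lee_fin ltW.
- apply: measurable_funeM; apply: measurableT_comp => //; exact/measurable_EFinP.
apply: filterS kC => x kCx _ /=.
under eq_integral do rewrite normrM EFinM muleC (ger0_norm (k0 _)).
rewrite ge0_integralZl//; last 2 first.
- exact/measurable_EFinP.
- by move=> y _; rewrite lee_fin.
by rewrite muleC lee_wpmul2r.
Qed.

Lemma kernel_mul2_integrable (g : T -> R) :
  mu.-integrable [set: T] (EFin \o g) ->
  (mu \x mu)%E.-integrable [set: T * T] (fun z => (k z * g z.2)%:E).
Proof.
move=> /kernel_mul1_integrable /integrable_swap; apply: eq_integrable => //.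
by move=> z _ /=; rewrite ksym.
Qed.

Lemma kernel_integrable :
  (mu \x mu)%E.-integrable [set: T * T] (EFin \o k).
Proof.
have i1 : mu.-integrable [set: T] (EFin \o cst (1 : R)).
  apply/integrableP; split; first exact/measurable_EFinP/measurable_cst.
  by under eq_integral do rewrite /= normr1; rewrite integral_cst// mul1e.
apply: eq_integrable (kernel_mul1_integrable _ i1) => //.
by move=> z _ /=; rewrite mulr1.
Qed.

Section Lp.
Variable p : R.
Hypothesis p1 : 1 <= p.

(** Since [|u| <= 1 + |u| ^ p], the product is dominated by [k + k |u| ^ p]. *)
Lemma kernel_mul_Lfun_integrable (u : T -> R) : u \in Lfun mu p%:E ->
  (mu \x mu)%E.-integrable [set: T * T] (fun z => (k z * u z.2)%:E).
Proof.
move=> lu; have [mf _] := (LfunE mu _ _).1 lu.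
have up := Lfun_integrable p1 lu.
have := integrableD measurableT kernel_integrable (kernel_mul2_integrable _ up).
apply: le_integrable => //.
  apply/measurable_EFinP; apply: measurable_funM => //.
  by apply: measurableT_comp => //; exact: measurable_snd.
move=> z _ /=; rewrite lee_fin [leRHS]ger0_norm; last first.
  by rewrite addr_ge0// mulr_ge0// powR_ge0.
rewrite normrM (ger0_norm (k0 _)) -[X in _ <= X + _]mulr1 -mulrDr ler_wpM2l//.
have [u1|u1] := leP 1 `|u z.2|.
  by rewrite (le_trans (le1r_powR u1 p1))// lerDr.
by rewrite (le_trans (ltW u1))// lerDl powR_ge0.
Qed.

Let K (x y : T) : R := k (x, y).

Lemma ae_kernel_mul_integrable (u : T -> R) : u \in Lfun mu p%:E ->
  {ae mu, forall x, mu.-integrable [set: T] (fun y => (K x y * u y)%:E)}.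
Proof. by move=> /kernel_mul_Lfun_integrable /ae_integrable1. Qed.

Lemma ae_kernel_integrable :
  {ae mu, forall x, mu.-integrable [set: T] (fun y => (K x y)%:E)}.
Proof. exact: ae_integrable1 kernel_integrable. Qed.

Lemma measurable_K_op (u : T -> R) : u \in Lfun mu p%:E ->
  measurable_fun [set: T] (K_op mu K u).
Proof.
move=> lu; have mF := measurable_fubini_F (kernel_mul_Lfun_integrable _ lu).
exact: measurableT_comp mF.
Qed.

Lemma measurable_h0 : measurable_fun [set: T] (h0 mu K).
Proof.
have mF := measurable_fubini_F kernel_integrable.
exact: measurableT_comp mF.
Qed.

Lemma h0_bound : {ae mu, forall x, 0 <= h0 mu K x <= C}.
Proof.
apply: filterS2 kC ae_kernel_integrable => x kCx ikx.
rewrite Rintegral_ge0//=; last by move=> y _; exact: k0.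
by rewrite -lee_fin /h0 /Rintegral fineK//; exact: integrable_fin_num.
Qed.

(** Jensen's inequality for the measure of density [k (x, .) / C], of total
mass at most 1: integrate [powR_tangent] at the point [s := I / C], where [I]
is the integral of [k (x, .) |u|]. *)
Lemma K_op_powR_le (u : T -> R) : u \in Lfun mu p%:E ->
  {ae mu, forall x, `|K_op mu K u x| `^ p <=
    C `^ (p - 1) * \int[mu]_y (K x y * `|u y| `^ p)}.
Proof.
move=> lu.
have iup := ae_integrable1 (kernel_mul2_integrable _ (Lfun_integrable p1 lu)).
apply: filterS3 (filterI h0_bound ae_kernel_integrable)
  (ae_kernel_mul_integrable _ lu) iup => x [/andP[_ hC] ik] iku {}iup.
have ikn : mu.-integrable [set: T] (EFin \o (fun y => K x y * `|u y|)).
  move/integrable_norm : iku; apply: eq_integrable => // y _ /=.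
  by rewrite normrM (ger0_norm (k0 _)).
pose I := \int[mu]_y (K x y * `|u y|).
have I0 : 0 <= I by apply: Rintegral_ge0 => y _; rewrite mulr_ge0// k0.
have KI : `|K_op mu K u x| <= I.
  apply: le_trans (le_normr_Rintegral measurableT iku) _.
  by under eq_Rintegral do rewrite normrM (ger0_norm (k0 _)).
set P := \int[mu]_y _.
pose s := I / C.
have s0 : 0 <= s by rewrite divr_ge0// ltW.
have Is : I = C * s by rewrite /s mulrC divfK// gt_eqF.
have p0 : 0 < p by rewrite (lt_le_trans _ p1).
(* With [I = C s], the integrated tangent inequality reads
   [p C s ^ p <= P + (p - 1) s ^ p h0 x], and [h0 x <= C]. *)
have CsP : C * s `^ p <= P.
  have tangent y : p * s `^ (p - 1) * (K x y * `|u y|) <=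
      K x y * `|u y| `^ p + (p - 1) * s `^ p * K x y.
    rewrite (_ : _ + _ = K x y * (`|u y| `^ p + (p - 1) * s `^ p)); last by ring.
    rewrite mulrCA ler_wpM2l ?k0//; exact: powR_tangent.
  have : p * s `^ (p - 1) * I <= P + (p - 1) * s `^ p * h0 mu K x.
    have iZ : mu.-integrable [set: T]
        (EFin \o (fun y => (p - 1) * s `^ p * K x y)).
      exact: (integrableZl measurableT _ ik).
    rewrite -RintegralZl// -RintegralZl// -RintegralD//.
    apply: le_Rintegral => //; first exact: (integrableZl measurableT _ ikn).
    exact: (integrableD measurableT iup iZ).
  have h : (p - 1) * s `^ p * h0 mu K x <= (p - 1) * s `^ p * C.
    by rewrite ler_wpM2l// mulr_ge0 ?powR_ge0// subr_ge0.
  have -> : p * s `^ (p - 1) * I = p * (C * s `^ p).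
    by rewrite Is -(mulr_powRB1 s0 p0); ring.
  by lra.
apply: (@le_trans _ _ (I `^ p)).
  by apply: ge0_ler_powR => //; rewrite ?nnegrE ?ltW.
have -> : I `^ p = C `^ (p - 1) * (C * s `^ p).
  by rewrite Is powRM ?(ltW C0)// -{1}(mulr_powRB1 (ltW C0) p0); ring.
by rewrite ler_wpM2l// powR_ge0.
Qed.

Lemma K_op_Lfun (u : T -> R) : u \in Lfun mu p%:E ->
  K_op mu K u \in Lfun mu p%:E.
Proof.
move=> lu; apply: (Lfun_powRP mu p _ p1).2; split; first exact: measurable_K_op.
have iG := integrable_fubini_F
  (kernel_mul2_integrable _ (Lfun_integrable p1 lu)).
set G := fubini_F _ _ in iG.
have /integrableP[mG Gy] := integrableZl measurableT (C `^ (p - 1)) iG.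
apply: le_lt_trans Gy; apply: ae_ge0_le_integral => //.
- by apply: measurable_norm_powR; exact: measurable_K_op.
- exact: measurableT_comp mG.
apply: filterS (K_op_powR_le _ lu) => x h _.
rewrite abseM /= (ger0_norm (powR_ge0 _ _)).
apply: (@le_trans _ _ ((C `^ (p - 1))%:E * (fine (G x))%:E)%E).
  by rewrite -EFinM lee_fin.
(* [fine] sends an infinite value to 0, so it is always below the absolute
   value. *)
rewrite lee_wpmul2l ?lee_fin ?powR_ge0//.
by case: (G x) => [r| |]/=; rewrite ?lee_fin ?ler_norm ?leey.
Qed.

Lemma K_op_sub_Lfun (u : T -> R) : u \in Lfun mu p%:E ->
  (fun x => K_op mu K u x - h0 mu K x * u x) \in Lfun mu p%:E.
Proof.
move=> lu; have [mf _] := (LfunE mu _ _).1 lu.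
apply: LfunB => //; first exact: K_op_Lfun.
apply: (Lfun_dominated mu p _ (C \o* u)) => //.
- by apply: measurable_funM => //; exact: measurable_h0.
- exact: Lfun_scale.
apply: filterS h0_bound => x /andP[h0x hC] /=.
by rewrite !normrM mulrC (ger0_norm h0x) (gtr0_norm C0) ler_wpM2l.
Qed.

(** * Green's formula for a symmetric kernel *)

Section Green.
Variables u v : T -> R.
Hypothesis lu : u \in Lfun mu p%:E.
Hypothesis lv : v \in Lfun mu (hoelder_conjugate p%:E).

Let meas_u : measurable_fun [set: T] u.
Proof. by have [] := (LfunE mu _ _).1 lu. Qed.

Let meas_v : measurable_fun [set: T] v.
Proof. by have [] := (LfunE mu _ _).1 lv. Qed.

Let cross (z : T * T) := (k z * u z.2 * v z.1)%:E.
Let diag (z : T * T) := (k z * (u z.1 * v z.1))%:E.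

(** The integral in [y] of the absolute value is [|v|] times the image of [|u|]
under the operator of kernel [k], hence a product of functions in conjugate
Lebesgue spaces. *)
Lemma cross_integrable : (mu \x mu)%E.-integrable [set: T * T] cross.
Proof.
have lau : (fun y => `|u y|) \in Lfun mu p%:E.
  apply: (Lfun_dominated mu p _ u) => //; first exact: measurableT_comp.
  by apply: aeW => x; rewrite normr_id.
have /integrableP[mKv Kv] := Lfun_mul_integrable mu p _ _ p1 (K_op_Lfun _ lau) lv.
have mcross : measurable_fun [set: T * T] cross.
  apply/measurable_EFinP; apply: measurable_funM.
    apply: measurable_funM => //.
    by apply: measurableT_comp => //; exact: measurable_snd.
  by apply: measurableT_comp => //; exact: measurable_fst.
apply/integrable12ltyP => //; apply: le_lt_trans Kv.
apply: ae_ge0_le_integral => //.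
- by move=> x _; exact: integral_ge0.
- apply: (measurable_fun_fubini_tonelli_F (fun z => `|cross z|)%E) => //.
  exact: measurableT_comp mcross.
- exact: measurableT_comp mKv.
apply: filterS (ae_kernel_mul_integrable _ lau) => x ix _.
rewrite abse_EFin normrM EFinM.
rewrite (@ger0_norm _ (K_op _ _ _ _)); last first.
  by apply: Rintegral_ge0 => y _; rewrite mulr_ge0// k0.
rewrite /K_op /Rintegral fineK ?integrable_fin_num//.
rewrite -ge0_integralZr//; last 2 first.
- by case/integrableP : ix.
- by move=> y _; rewrite lee_fin mulr_ge0// k0.
apply: ge0_le_integral => //.
- apply: measurableT_comp => //.
  by apply: measurableT_comp => //; exact: measurable_pair1.
- apply: emeasurable_funM => //; by case/integrableP : ix.
by move=> y _; rewrite /cross/= !normrM (ger0_norm (k0 _)).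
Qed.

Lemma diag_integrable : (mu \x mu)%E.-integrable [set: T * T] diag.
Proof.
exact: (kernel_mul1_integrable _ (Lfun_mul_integrable mu p u v p1 lu lv)).
Qed.

(** Pointwise in [x], the factors [v x] and [u x * v x] may be moved inside the
integrals in [y], since [k (x, .)] and [k (x, .) u] are integrable for almost
every [x]. *)
Lemma pairing_fubini :
  pairing mu (fun x => K_op mu K u x - h0 mu K x * u x) v =
  (\int[mu \x mu]_z cross z - \int[mu \x mu]_z diag z)%E.
Proof.
have icd := integrableB measurableT cross_integrable diag_integrable.
rewrite -integralB//; [|exact: cross_integrable|exact: diag_integrable].
rewrite -integral12_prod_meas1//.
apply: ae_eq_integral => //.
- apply/measurable_EFinP; apply: measurable_funM => //.
  by have [] := (LfunE mu _ _).1 (K_op_sub_Lfun _ lu).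
- exact: measurable_fubini_F icd.
apply: filterS2 ae_kernel_integrable (ae_kernel_mul_integrable _ lu) => x ik iku _.
rewrite /fubini_F /cross /diag /=.
transitivity (\int[mu]_y (v x * (K x y * u y) - (u x * v x) * K x y))%:E.
  rewrite RintegralB// ?RintegralZl//.
  - by congr EFin; rewrite /K_op /h0; ring.
  - exact: (integrableZl measurableT _ iku).
  - exact: (integrableZl measurableT _ ik).
rewrite fineK; last first.
  apply: integrable_fin_num => //.
  apply: (integrableB measurableT (integrableZl measurableT (v x) iku)
    (integrableZl measurableT (u x * v x) ik)).
by apply: eq_integral => y _; rewrite /K -EFinB; congr EFin; ring.
Qed.

Let green_integrandE :
  (fun z : T * T => (k z * (u z.2 - u z.1) * (v z.2 - v z.1))%:E) =
  ((diag \+ (diag \o swap_pair)) \- (cross \+ (cross \o swap_pair)))%E.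
Proof.
apply/funext => -[x y] /=.
rewrite /diag /cross /= -[k (y, x)]/(k (swap_pair (x, y))) ksym.
by congr EFin; ring.
Qed.

Lemma green_integrable : (mu \x mu)%E.-integrable [set: T * T]
  (fun z => (k z * (u z.2 - u z.1) * (v z.2 - v z.1))%:E).
Proof.
have ic := cross_integrable; have id := diag_integrable.
rewrite green_integrandE; apply: integrableB => //.
  exact: (integrableD measurableT id (integrable_swap mu _ id)).
exact: (integrableD measurableT ic (integrable_swap mu _ ic)).
Qed.

Lemma symmetric_green :
  pairing mu (fun x => K_op mu K u x - h0 mu K x * u x) v =
  ((- 2^-1)%:E * \int[mu]_x \int[mu]_y
     (K x y * (u y - u x) * (v y - v x))%:E)%E.
Proof.
rewrite pairing_fubini.
rewrite [X in ((- 2^-1)%:E * X)%E](integral12_prod_meas1 green_integrable).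
rewrite green_integrandE.
have ic := cross_integrable; have id := diag_integrable.
have ics := integrable_swap mu _ ic; have ids := integrable_swap mu _ id.
have iS := integrableD measurableT id ids.
have iN := integrableD measurableT ic ics.
rewrite integralB// !integralD// !integral_swap//.
have fc := integrable_fin_num measurableT ic.
have fd := integrable_fin_num measurableT id.
rewrite -(fineK fc) -(fineK fd) -!EFinD -EFinM; congr EFin.
by field.
Qed.
End Green.
End Lp.
End symmetric_kernel.

(** * Transfer to an almost everywhere defined kernel *)

Section complete_measure.
Context {d : measure_display} {R : realType} {T : measurableType d}.
Variable mu : {measure set T -> \bar R}.
Hypothesis cmu : measure_is_complete mu.

(** Completeness makes [g] measurable, so that it may be any function that
agrees with [f] outside a null set. *)
Lemma ae_eq_integral_complete (f g : T -> \bar R) :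
  measurable_fun [set: T] f -> {ae mu, forall x, f x = g x} ->
  (\int[mu]_x f x = \int[mu]_x g x)%E.
Proof.
move=> mf fg; have fg' : ae_eq mu [set: T] f g.
  by apply: filterS fg => x.
by apply: ae_eq_integral => //; exact: ae_measurable_fun fg' mf.
Qed.

Lemma ae_eq_Lfun (p : R) (f g : T -> R) : 1 <= p ->
  {ae mu, forall x, f x = g x} -> f \in Lfun mu p%:E -> g \in Lfun mu p%:E.
Proof.
move=> p1 fg lf; have [mf _] := (LfunE mu _ _).1 lf.
apply: (Lfun_dominated mu p g f) => //.
  apply/measurable_EFinP; move/measurable_EFinP : mf.
  apply: (ae_measurable_fun cmu) => //.
  by apply: filterS fg => x /= ->.
by apply: filterS fg => x ->.
Qed.

End complete_measure.

Section symmetric_representative.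
Context {d : measure_display} {R : realType} {T : measurableType d}.
Variable mu : {sigma_finite_measure set T -> \bar R}.
Variable J : T -> T -> R.

(** Averaging a measurable version of [J] with its transpose, then taking the
positive part, changes it only on a null set and makes symmetry and
nonnegativity hold at every point. *)
Lemma symmetric_representative :
  kernel_measurable mu J -> kernel_ge0 mu J -> kernel_sym mu J ->
  exists k : T * T -> R,
    [/\ measurable_fun [set: T * T] k, forall z, 0 <= k z,
        forall z, k (swap_pair z) = k z
      & {ae (mu \x mu)%E, forall z, J z.1 z.2 = k z}].
Proof.
move=> [J' mJ' JJ'] J0 Js.
exists (fun z => Num.max 0 ((J' z + J' (swap_pair z)) / 2)); split.
- apply: measurable_maxr => //; apply: measurable_funM => //.
  apply: measurable_funD => //.
  by apply: measurableT_comp => //; exact: measurable_swap.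
- by move=> z; rewrite le_max lexx.
- by move=> [x y]; rewrite /swap_pair/= addrC.
apply: filterS3 (filterI J0 Js) JJ' (ae_swap _ _ JJ') => -[x y]/= [Jge0 JC] <- <-.
by rewrite -JC mulrDl -splitr; apply/esym/max_idPr.
Qed.

Lemma symmetric_representative_bound (k : T * T -> R) :
  measurable_fun [set: T * T] k -> (forall z, 0 <= k z) ->
  {ae (mu \x mu)%E, forall z, J z.1 z.2 = k z} ->
  bochner_Lfun mu +oo%E 1%E J ->
  exists2 C : R, 0 < C &
    {ae mu, forall x, (\int[mu]_y (k (x, y))%:E <= C%:E)%E}.
Proof.
move=> mk k0 /ae_section Jk [J1 _ /Lnormy_bound[M M0 JM]].
exists (M + 1); first by rewrite ltr_wpDl.
apply: filterS3 Jk J1 JM => x Jkx /(LfunE mu _ _).1[mJx _].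
rewrite gee0_abs ?Lnorm_ge0// Lnorm1 => JMx.
apply: (@le_trans _ _ M%:E); last by rewrite lee_fin lerDl.
apply: le_trans JMx; rewrite le_eqVlt; apply/orP; left; apply/eqP.
apply: ae_eq_integral => //.
- apply/measurable_EFinP.
  by apply: measurableT_comp => //; exact: measurable_pair1.
- by apply: measurableT_comp => //; exact/measurable_EFinP.
by apply: filterS Jkx => y /= -> _; rewrite ger0_norm.
Qed.
End symmetric_representative.

Section green_complete.
Context {d : measure_display} {R : realType} {T : measurableType d}.
Variable mu : {sigma_finite_measure set T -> \bar R}.
Hypothesis muT : (mu [set: T] < +oo)%E.
Hypothesis cmu : measure_is_complete mu.
Variables (p : R) (J : T -> T -> R).
Hypothesis p1 : 1 <= p.
Hypothesis mJ : kernel_measurable mu J.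
Hypothesis J0 : kernel_ge0 mu J.
Hypothesis Js : kernel_sym mu J.
Hypothesis J1 : bochner_Lfun mu +oo%E 1%E J.
Variables u v : T -> R.
Hypothesis lu : u \in Lfun mu p%:E.
Hypothesis lv : v \in Lfun mu (hoelder_conjugate p%:E).

Lemma complete_green :
  (fun x => K_op mu J u x - h0 mu J x * u x) \in Lfun mu p%:E /\
  pairing mu (fun x => K_op mu J u x - h0 mu J x * u x) v =
    ((- 2^-1)%:E * \int[mu]_x \int[mu]_y
       (J x y * (u y - u x) * (v y - v x))%:E)%E.
Proof.
have [k [mk k0 ks Jk]] := symmetric_representative mu J mJ J0 Js.
have [C C0 kC] := symmetric_representative_bound mu J k mk k0 Jk J1.
have [meas_u _] := (LfunE mu _ _).1 lu; have [meas_v _] := (LfunE mu _ _).1 lv.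
pose K x y := k (x, y).
have mK x : measurable_fun [set: T] (K x).
  by apply: measurableT_comp => //; exact: measurable_pair1.
(* The integrals [K_op], [h0] and the double integral in the formula are all
   instances of [F]. *)
have KJ (F : T -> T -> R -> R) :
    (forall x, measurable_fun [set: T] (fun y => F x y (K x y))) ->
    {ae mu, forall x, \int[mu]_y (F x y (K x y))%:E =
                      \int[mu]_y (F x y (J x y))%:E}%E.
  move=> mF; apply: filterS (ae_section mu _ Jk) => x Jkx.
  apply: ae_eq_integral_complete => //; first exact/measurable_EFinP.
  by apply: filterS Jkx => y /= ->.
have Au : {ae mu, forall x, K_op mu K u x - h0 mu K x * u x =
                            K_op mu J u x - h0 mu J x * u x}.
  have Ku := KJ (fun _ y t => t * u y) (fun x => measurable_funM (mK x) meas_u).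
  apply: filterS2 Ku (KJ (fun _ _ => id) mK) => x.
  by rewrite /K_op /h0 /Rintegral => -> ->.
have lKu := K_op_sub_Lfun mu muT k C mk k0 ks C0 kC p p1 u lu.
split; first exact: ae_eq_Lfun Au lKu.
transitivity (pairing mu (fun x => K_op mu K u x - h0 mu K x * u x) v).
  symmetry; apply: ae_eq_integral_complete => //.
    apply/measurable_EFinP; apply: measurable_funM => //.
    by have [] := (LfunE mu _ _).1 lKu.
  by apply: filterS Au => x ->.
rewrite (symmetric_green mu muT k C mk k0 ks C0 kC p p1 u v lu lv); congr (_ * _)%E.
have ig := green_integrable mu muT k C mk k0 ks C0 kC p p1 u v lu lv.
apply: ae_eq_integral_complete => //; first exact: measurable_fubini_F ig.
apply: (KJ (fun x y t => t * (u y - u x) * (v y - v x))) => x.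
apply: measurable_funM; last exact: measurable_funB.
by apply: measurable_funM => //; exact: measurable_funB.
Qed.
End green_complete.

Theorem proposition3p22 (d : measure_display) (R : realType)
    (Omega : metricMeasurableType d R)
    (mu : {sigma_finite_measure set Omega -> \bar R})
    (p : R) (J : Omega -> Omega -> R) :
  metric_measure_space mu ->
  (mu [set: Omega] < +oo)%E ->
  1 <= p ->
  kernel_measurable mu J ->
  kernel_ge0 mu J ->
  kernel_sym mu J ->
  bochner_Lfun mu +oo%E 1%E J ->
  bochner_Lfun mu p%:E (hoelder_conjugate p%:E) J ->
  (forall u v : Omega -> R,
    u \in Lfun mu p%:E -> v \in Lfun mu (hoelder_conjugate p%:E) ->
    (fun x => K_op mu J u x - h0 mu J x * u x) \in Lfun mu p%:E /\
    pairing mu (fun x => K_op mu J u x - h0 mu J x * u x) v =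
      ((- 2^-1)%:E * \int[mu]_x \int[mu]_y
         (J x y * (u y - u x) * (v y - v x))%:E)%E) /\
  (p = 2 -> forall u : Omega -> R, u \in Lfun mu 2%:E ->
    pairing mu (fun x => K_op mu J u x - h0 mu J x * u x) u =
      ((- 2^-1)%:E * \int[mu]_x \int[mu]_y
         (J x y * (u y - u x) ^+ 2)%:E)%E).
Proof.
move=> mms muT p1 mJ J0 Js J1 _.
have green := complete_green mu muT (mms_complete mms) p J p1 mJ J0 Js J1.
split=> [//|p2 u lu].
have := green u u; rewrite p2 hoelder_conjugate2 => /(_ lu lu)[_ ->].
congr (_ * _)%E; apply: eq_integral => x _; apply: eq_integral => y _.
by rewrite -mulrA -expr2.
Qed.
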